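(* Let $a,b,p,q$ be complex numbers with $p\neq 0$, $q\neq 0$, and let $(W_j)$, $(U_j)$ be as defined in the context. If $n$ is a non-negative integer and $r$, $s$ and $t$ are any integers, then \[ \sum_{k = 0}^n ( - 1)^k \binom nk^3 U_{r + s}^{n - k} U_s^k W_{t + rk} = \sum_{k = 0}^n ( - 1)^k \binom{n + k}{2k}\binom{2k}{k}\binom{n - k}{k} q^{s(n - 2k)} U_{r + s}^k U_s^k U_r^{n - 2k} W_{t + rk - s(n - 2k)}. \]
   Context: The Horadam sequence $W_j=W_j(a,b;p,q)$ is defined by $W_0=a$, $W_1=b$, $W_j=pW_{j-1}-qW_{j-2}$ for $j\ge 2$, and extended to negative indices by $W_{-j}=\frac{1}{q}(pW_{-j+1}-W_{-j+2})$. The Lucas sequence of the first kind is $U_j=W_j(0,1;p,q)$. Binomial coefficients $\binom{N}{k}$ with $k>N\ge 0$ are $0$ (so terms with $2k>n$ vanish). *)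

(* Defs.v *)
From mathcomp Require Import all_boot all_order all_algebra.

Set Implicit Arguments.
Unset Strict Implicit.
Unset Printing Implicit Defensive.

Import GRing.Theory.
Local Open Scope ring_scope.

Section Horadam.
Variables (F : fieldType) (a b p q : F).

Fixpoint horadam_nonneg (n : nat) : F :=
  match n with
  | 0 => a
  | 1 => b
  | (m.+1 as m').+1 => p * horadam_nonneg m' - q * horadam_nonneg m
  end.

(* horadam_nonpos n is W_{-n}. In W_{-n} = (p W_{-n+1} - W_{-n+2}) / q the
   last index is positive only for n = 1, where it refers to W_1 = b. *)
Fixpoint horadam_nonpos (n : nat) : F :=
  match n with
  | 0 => a
  | 1 => q^-1 * (p * a - b)
  | (m.+1 as m').+1 => q^-1 * (p * horadam_nonpos m' - horadam_nonpos m)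
  end.

(* Negz n is the integer -(n+1). *)
Definition horadam (j : int) : F :=
  match j with
  | Posz n => horadam_nonneg n
  | Negz n => horadam_nonpos n.+1
  end.

End Horadam.

Definition lucasU (F : fieldType) (p q : F) (j : int) : F :=
  horadam 0 1 p q j.

(* Main.v *)
(* MacMahon's identity
     sum_k C(n,k)^3 x^(n-k) y^k
       = sum_k C(n+k,2k) C(2k,k) C(n-k,k) x^k y^k (x+y)^(n-2k)
   holds for commuting x, y: comparing coefficients, it reduces to
     sum_k C(i,k) C(m,k) C(N+k,i+m) = C(N,i) C(N,m)
   at N = n = i+m, which follows from Vandermonde's convolution used three times. If alpha,
   beta are the roots of X^2 - p X + q, take x = U_(r+s), y = -U_s alpha^r;
   then x + y = beta^s U_r = q^s alpha^(-s) U_r. Multiplying by alpha^t and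
   applying the linear form that sends alpha^j to W_j gives the theorem. The
   companion matrix plays the role of alpha, so that the double root case
   p^2 = 4q needs no separate treatment. *)
From HB Require Import structures.
Require Import Defs.
From mathcomp Require Import all_boot all_order all_algebra.
From mathcomp Require Import reals complex zify ring.

Set Implicit Arguments.
Unset Strict Implicit.
Unset Printing Implicit Defensive.

Import GRing.Theory.

(** * Binomial identities over the natural numbers *)

Lemma bin_trinomial N j i : i <= j -> 'C(N, j) * 'C(j, i) = 'C(N, i) * 'C(N - i, j - i).
Proof.
move=> ij; have [jN|Nj] := leqP j N; last first.
  rewrite bin_small // mul0n; have [iN|Ni] := leqP i N.
    by rewrite [X in _ = _ * X]bin_small ?muln0 //; lia.
  by rewrite bin_small.
have iN := leq_trans ij jN.
have e1 := bin_fact jN; have e2 := bin_fact ij; have e3 := bin_fact iN.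
have e4 : j - i <= N - i by lia.
have {e4} := bin_fact e4; rewrite subnBA // subnK // => e4.
have p1 := fact_gt0 i; have p2 := fact_gt0 (j - i); have p3 := fact_gt0 (N - j).
have E : 0 < i`! * (j - i)`! * (N - j)`! by rewrite !muln_gt0 p1 p2.
apply/eqP; rewrite -(eqn_pmul2r E); apply/eqP.
transitivity N`!.
  by rewrite -e1 -e2; ring.
by rewrite -e3 -e4; ring.
Qed.

(** Expand ['C(N + k, i + m)] by Vandermonde with index [l], regroup by trinomial revision, then sum
    over [k] and finally over [l], each time by Vandermonde. *)
Lemma bin_product_sum N i m :
  \sum_(k < i.+1) 'C(i, k) * 'C(m, k) * 'C(N + k, i + m) = 'C(N, i) * 'C(N, m).
Proof.
have [iN|Ni] := leqP i N; last first.
  rewrite [X in _ = X * _]bin_small // mul0n big1 // => k _.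
  have [km|mk] := leqP k m; last by rewrite [X in _ * X * _]bin_small ?muln0.
  by rewrite [X in _ * X]bin_small ?muln0; lia.
(* The factor [l <= k] removes the indices where [k - l] truncates to 0 and ['C(i - l, k - l)] would
   be 1. *)
transitivity (\sum_(k < i.+1) \sum_(l < m.+1)
   'C(m, k) * 'C(i - l, k - l) * (l <= k) * ('C(i, l) * 'C(N, i + m - l))).
  apply: eq_bigr => k _.
  have [km|mk] := leqP k m; last first.
    rewrite [X in _ * X * _]bin_small // muln0 mul0n big1 // => l _.
    by rewrite bin_small.
  rewrite addnC -binomial.Vandermonde big_distrr /=.
  rewrite (big_ord_widen_cond (i + m).+1 predT
    (fun l => 'C(m, k) * 'C(i - l, k - l) * (l <= k) * ('C(i, l) * 'C(N, i + m - l)))) ?ltnS ?leq_addl //=.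
  rewrite [RHS]big_mkcond; apply: eq_bigr => l _ /=.
  rewrite ltnS; have [lk|kl] := leqP l k; last first.
    by rewrite [X in _ * (X * _)]bin_small // mul0n !muln0 mul0n if_same.
  rewrite (leq_trans lk km).
  rewrite muln1 [LHS]mulnACA (bin_trinomial i lk); ring.
rewrite exchange_big /=.
transitivity (\sum_(l < m.+1) 'C(N, i) * ('C(i, l) * 'C(N - i, m - l))); last first.
  by rewrite -big_distrr /= binomial.Vandermonde subnKC.
apply: eq_bigr => l _; rewrite -big_distrl /=.
have [li|il] := leqP l i; last by rewrite ['C(i, l)]bin_small // !muln0.
have lm : l <= m by case: l {li} => /= l; lia.
(* This is again a convolution, because ['C(i - l, k - l) = 'C(i - l, i - k)] for [l <= k]. *)
suff -> : \sum_(k < i.+1) 'C(m, k) * 'C(i - l, k - l) * (l <= k) = 'C(m + i - l, i).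
  have := bin_trinomial N (leq_addr (m - l) i).
  rewrite addKn [(m + i)%N]addnC -addnBA // => e.
  by rewrite mulnCA [X in _ * X]mulnC e mulnCA.
rewrite -addnBA // -binomial.Vandermonde; apply: eq_bigr => -[k /= ki] _.
have [lk|kl] := leqP l k; last by rewrite muln0 [X in _ * X]bin_small ?muln0 //; lia.
rewrite muln1; congr (_ * _); rewrite -bin_sub; last lia.
by congr 'C(_, _); lia.
Qed.

(** Coefficient of [x ^+ (n - j) * y ^+ j] in MacMahon's identity. Two of the three factors, written
    ['C(n, j) * 'C(n, n - j)], are expanded by [bin_product_sum]; the sums then agree term by
    term. *)
Lemma bin_cube_sum n j : j <= n ->
  \sum_(k < n.+1) 'C(n + k, 2 * k) * 'C(2 * k, k) * 'C(n - k, k)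
      * ((k <= j) * 'C(n - 2 * k, j - k)) = 'C(n, j) ^ 3.
Proof.
move=> jn.
have -> : 'C(n, j) ^ 3 = 'C(n, j) * ('C(n, j) * 'C(n, n - j)).
  by rewrite bin_sub // !expnS expn0 muln1.
rewrite -bin_product_sum subnKC // big_distrr /=.
rewrite (big_ord_widen n.+1
  (fun k => 'C(n, j) * ('C(j, k) * 'C(n - j, k) * 'C(n + k, n)))) ?ltnS //.
rewrite [RHS]big_mkcond; apply: eq_bigr => -[k /= kn] _; rewrite ltnS.
have [kj|] := leqP k j; last by rewrite !muln0.
rewrite mul1n.
(* For [k > n - j] both terms vanish; on the left, either [2 * k > n] or [j - k > n - 2 * k]. *)
have [kd|dk] := leqP k (n - j); last first.
  rewrite [X in _ = _ * (_ * X * _)]bin_small // muln0 !mul0n muln0.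
  have [h|h] := leqP k (n - k); last by rewrite [X in _ * X * _]bin_small // muln0 mul0n.
  by rewrite [X in _ * X]bin_small ?muln0 //; lia.
(* Both sides equal [(n+k)! / (k!^3 (j-k)! (n-j-k)!)]. *)
have f1 : 2 * k <= n + k by lia.
have f2 : k <= 2 * k by lia.
have f3 : k <= n - k by lia.
have f4 : j - k <= n - 2 * k by lia.
have f5 : n <= n + k by lia.
have {f1} := bin_fact f1; have {f2} := bin_fact f2; have {f3} := bin_fact f3.
have {f4} := bin_fact f4; have {f5} := bin_fact f5.
have := bin_fact jn; have := bin_fact kj; have := bin_fact kd.
have -> : 2 * k - k = k by lia.
have -> : n - k - k = n - 2 * k by lia.
have -> : n - 2 * k - (j - k) = n - j - k by lia.
have -> : n + k - 2 * k = n - k by lia.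
have -> : n + k - n = k by lia.
move=> e1 e2 e3 e4 e5 e6 e7 e8.
have E : 0 < k`! * k`! * k`! * (j - k)`! * (n - j - k)`!.
  by rewrite !muln_gt0 !fact_gt0.
apply/eqP; rewrite -(eqn_pmul2r E); apply/eqP.
transitivity (n + k)`!.
  by rewrite -e8 -e7 -e6 -e5; ring.
by rewrite -e4 -e3 -e2 -e1; ring.
Qed.

(** * MacMahon's identity for commuting ring elements *)

Local Open Scope ring_scope.

Lemma macmahon_comm (A : nzRingType) (x y : A) n : GRing.comm x y ->
  \sum_(k < n.+1) (x ^+ (n - k) * y ^+ k) *+ ('C(n, k) ^ 3)%N =
  \sum_(k < n.+1) (x ^+ k * y ^+ k * (x + y) ^+ (n - 2 * k))
     *+ ('C(n + k, 2 * k) * 'C(2 * k, k) * 'C(n - k, k))%N.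
Proof.
move=> xy.
transitivity (\sum_(k < n.+1) \sum_(j < n.+1) (x ^+ (n - j) * y ^+ j)
  *+ ('C(n + k, 2 * k) * 'C(2 * k, k) * 'C(n - k, k)
      * ((k <= j) * 'C(n - 2 * k, j - k)))%N).
  rewrite exchange_big; apply: eq_bigr => -[j /= jn] _.
  by rewrite sumrMnr bin_cube_sum.
apply: eq_bigr => -[k /= kn] _.
have [h|h] := leqP k (n - k); last first.
  rewrite ['C(n - k, k)]bin_small // muln0 mulr0n big1 // => j _.
under eq_bigr do rewrite mulnC mulrnA.
rewrite sumrMnl; congr (_ *+ _).
rewrite exprDn_comm // big_distrr /=.
rewrite -!(big_mkord xpredT (fun j => (x ^+ (n - j) * y ^+ j) *+ ((k <= j) * 'C(n - 2 * k, j - k)))).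
(* Only [k <= j <= n - k] contributes; the shift [j = i + k] then matches the binomial expansion of
   [(x + y) ^+ (n - 2 * k)]. *)
rewrite (@big_cat_nat _ _ _ k) //=; last lia.
rewrite [X in X + _]big_nat big1 ?add0r; last first.
  by move=> j /andP[_ jk]; rewrite leqNgt jk mul0n mulr0n.
rewrite (@big_cat_nat _ _ _ (n - k).+1) //=; try lia.
rewrite [X in _ + X]big_nat [X in _ + X]big1 ?addr0; last first.
  by move=> j jk; rewrite bin_small ?muln0 ?mulr0n //; lia.
rewrite -{1}[k]add0n big_addn.
have -> : ((n - k).+1 - k = (n - 2 * k).+1)%N by lia.
rewrite big_mkord; apply: eq_bigr => -[i /= hi] _.
rewrite leq_addl mul1n addnK mulrnAr; congr (_ *+ _).
have c : GRing.comm (y ^+ k) (x ^+ (n - 2 * k - i)).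
  by apply/commrX/commr_sym/commrX.
rewrite mulrA -(mulrA (x ^+ k)) c mulrA -exprD -mulrA -exprD.
by congr (_ ^+ _ * _ ^+ _); lia.
Qed.

(** * The recurrence on all integers *)

Lemma horadam_rec (F : fieldType) (a b p q : F) (j : int) : q != 0 ->
  horadam a b p q (j + 2) = p * horadam a b p q (j + 1) - q * horadam a b p q j.
Proof.
move=> q0; case: j => [n|[|[|n]]].
- have -> : Posz n + 2 = n.+2 by lia.
  by have -> : Posz n + 1 = n.+1 by lia.
(* At [j = -1] and [j = -2] the recurrence spans both branches of [horadam]. *)
- by rewrite /=; field.
- by rewrite /=; field.
have -> : Negz n.+2 + 2 = Negz n by lia.
have -> : Negz n.+2 + 1 = Negz n.+1 by lia.
by rewrite [_ (Negz n.+2)]/= (mulrA q) divff ?mul1r ?subKr.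
Qed.

(** Since [q] is invertible, the recurrence also runs backwards from two consecutive values. Values
    in a module cover both powers in an algebra and scalar sequences. *)
Lemma linear_rec_unique (F : fieldType) (V : lmodType F) (p q : F)
    (f g : int -> V) : q != 0 ->
    (forall j, f (j + 2) = p *: f (j + 1) - q *: f j) ->
    (forall j, g (j + 2) = p *: g (j + 1) - q *: g j) ->
  f 0 = g 0 -> f 1 = g 1 -> f =1 g.
Proof.
move=> q0 rf rg fg0 fg1.
suff h j : f j = g j /\ f (j + 1) = g (j + 1) by move=> j; case: (h j).
elim/int_rect: j => [|n [IH0 IH1]|n [IH0 IH1]].
- by rewrite add0r.
- have -> : n.+1%:Z = n%:Z + 1 by lia.
  by split=> //; rewrite -addrA rf rg IH0 IH1.
have e : - n%:Z = - n.+1%:Z + 1 by lia.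
rewrite -e; split=> //; apply: (scalerI q0).
have rf' : q *: f (- n.+1%:Z) = p *: f (- n%:Z) - f (- n%:Z + 1).
  by rewrite e -addrA rf subKr.
have rg' : q *: g (- n.+1%:Z) = p *: g (- n%:Z) - g (- n%:Z + 1).
  by rewrite e -addrA rg subKr.
by rewrite rf' rg' IH0 IH1.
Qed.

(** * Integer powers of a root of [X^2 - p X + q] in an algebra *)

Section QuadraticRoot.
Variables (F : fieldType) (p q : F) (A : unitAlgType F) (x : A).
Hypotheses (q0 : q != 0) (xx : x * x = p *: x - q%:A).

Local Notation U := (lucasU p q).
Local Notation y := (q *: x^-1).

(** The relation gives [x * (p - x) = q], whence the inverse. *)
Lemma quadratic_unit : x \is a GRing.unit.
Proof.
apply/unitrP; exists (q^-1 *: (p%:A - x)).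
rewrite -scalerAl -scalerAr mulrBl mulrBr mulr_algl mulr_algr xx subKr.
by rewrite scalerA mulVf // scale1r.
Qed.

(** Divide the quadratic relation by [x]. Together with [x * y = q] this makes [y] the conjugate
    root. *)
Lemma quadratic_conj : x + y = p%:A.
Proof.
have xu := quadratic_unit.
rewrite -[x in x + _](mulrK xu) xx mulrBl -scalerAl mulrV // mulr_algl.
by rewrite subrK.
Qed.

(** Lets [quadratic_expz] be applied to [y] as well. *)
Lemma quadratic_conj_sq : y * y = p *: y - q%:A.
Proof.
have xu := quadratic_unit.
have -> : p *: y = p%:A * y by rewrite mulr_algl.
by rewrite -quadratic_conj mulrDl -[x * y]scalerAr mulrV // addrAC subrr add0r.
Qed.

(** The constant term is [- q * U (j - 1)], written with forward shifts only. *)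
Lemma quadratic_expz j : x ^ j = U j *: x + (U (j + 1) - p * U j)%:A.
Proof.
have xu := quadratic_unit; move: j.
apply: (linear_rec_unique (p := p) q0) => // [j|j||].
- by rewrite !exprzDr // -[X in _ * X]/(x * x) xx mulrBr -!scalerAr mulr1.
- have -> : j + 2 + 1 = (j + 1) + 2 :> int by ring.
  rewrite /lucasU !horadam_rec // (_ : j + 1 + 1 = j + 2) ?horadam_rec //; last ring.
  rewrite !scalerDr !scalerA opprD addrACA -!scalerBl.
  by congr (_ *: _ + _ *: _); ring.
- by rewrite add0r scale0r add0r mulr0 subr0 scale1r.
by rewrite /= scale1r mulr0 subr0 !mulr1 subrr scale0r addr0.
Qed.

End QuadraticRoot.

Section QuadraticConjugate.
Variables (F : fieldType) (p q : F) (A : unitAlgType F) (x : A).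
Hypotheses (q0 : q != 0) (xx : x * x = p *: x - q%:A).

Local Notation U := (lucasU p q).
Local Notation y := (q *: x^-1).

Let xu : x \is a GRing.unit := quadratic_unit q0 xx.

Lemma quadratic_conj_expz j : y ^ j = q ^ j *: x ^ (- j).
Proof.
case: j => n.
  by rewrite -!exprnP exprZn exprVn exprnN.
have qu : q \is a GRing.unit by rewrite unitfE.
rewrite NegzE -!invr_expz -!exprnP exprZn invrZ ?unitrX ?unitrV //.
by rewrite exprVn.
Qed.

(* With [x = alpha] and [y = beta] this is
   [U_(r+s) - U_s alpha^r = beta^s U_r]. *)
Lemma lucasU_add_quadratic r s :
  (U (r + s))%:A = U s *: x ^ r + U r * q ^ s *: x ^ (- s).
Proof.
have yu : y \is a GRing.unit by rewrite scaler_unit ?unitrV ?unitfE.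
rewrite -scalerA -quadratic_conj_expz; move: r.
apply: (linear_rec_unique (p := p) q0) => // [j|j||].
- by rewrite (addrAC j 2) (addrAC j 1) /lucasU horadam_rec // scalerBl -!scalerA.
- rewrite !exprzDr // -[X in _ * X]/(x * x) xx mulrBr -!scalerAr mulr1.
  rewrite /lucasU horadam_rec // expr1z scalerBl -!scalerA !scalerBr !scalerDr.
  rewrite opprD addrACA; congr (_ + _ + _); rewrite !scalerA.
  + by rewrite mulrC.
  by rewrite mulrC.
- by rewrite !add0r /lucasU scale0r addr0.
(* At [r = 1], expanding [y ^ s] produces [U s *: (x + y)], and [x + y = p] cancels the term
   [- p * U s]. *)
rewrite expr1z [U 1]/= scale1r (quadratic_expz q0 (quadratic_conj_sq q0 xx)).
rewrite addrA -scalerDr (quadratic_conj q0 xx) scalerA -scalerDl (addrC 1).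
by rewrite mulrC subrKC.
Qed.

Lemma scalar_quadratic_expz (a b : F) (f : {scalar A}) :
  f 1 = a -> f x = b -> forall j, f (x ^ j) = horadam a b p q j.
Proof.
move=> f1 fx; apply: (linear_rec_unique (V := F^o) (p := p) q0) => // [j|j].
  by rewrite !exprzDr // -[X in _ * X]/(x * x) xx mulrBr -!scalerAr mulr1 linearB !linearZ.
exact: horadam_rec.
Qed.

(** The theorem before the linear form is applied, with [x ^ j] in place of [W_j]. *)
Lemma quadratic_cube_sum n r s t :
  \sum_(k < n.+1)
    ((-1) ^+ k * 'C(n, k)%:R ^+ 3 * U (r + s) ^+ (n - k) * U s ^+ k)
      *: x ^ (t + r * k%:Z)
  = \sum_(k < n.+1)
    ((-1) ^+ k * 'C(n + k, 2 * k)%:R * 'C(2 * k, k)%:R * 'C(n - k, k)%:R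
     * q ^ (s * (n%:Z - 2 * k%:Z))
     * U (r + s) ^+ k * U s ^+ k * U r ^ (n%:Z - 2 * k%:Z))
       *: x ^ (t + r * k%:Z - s * (n%:Z - 2 * k%:Z)).
Proof.
have c : GRing.comm (U (r + s))%:A (- U s *: x ^ r).
  by rewrite /GRing.comm mulr_algl mulr_algr.
have /(congr1 (fun z => x ^ t * z)) := macmahon_comm n c.
(* Only the base of the power [n - 2 * k] is rewritten: the multiples of [x ^ r] cancel and leave
   [U r * q ^ s *: x ^ (- s)]. *)
rewrite [X in X + _ *: _]lucasU_add_quadratic scaleNr.
rewrite [X in X - _]addrC addrK -scaleNr !mulr_sumr => e.
transitivity (\sum_(k < n.+1) x ^ t * ((U (r + s))%:A ^+ (n - k) * (- U s *: x ^ r) ^+ k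
  *+ 'C(n, k) ^ 3)).
  apply: eq_bigr => k _.
  rewrite mulrnAr !exprZn expr1n mulr_algl -!scalerAr scalerA -scaler_nat scalerA.
  rewrite [x ^ (t + _)]exprzDr // -exprz_exp -exprnP (exprNn (U s)) natrX.
  by congr (_ *: (_ * _)); ring.
rewrite {}e; apply: eq_bigr => -[k /= kn] _.
(* For [2 * k > n] the integer exponent is negative while the natural one truncates to 0; both terms
   vanish through ['C(n - k, k)]. *)
have [h|h] := leqP k (n - k); last first.
  by rewrite ['C(n - k, k)]bin_small // muln0 mulr0n mulr0 !(mulr0, mul0r) scale0r.
have -> : n%:Z - 2 * k%:Z = (n - 2 * k)%N by lia.
rewrite -scaler_nat !exprZn expr1n mulr_algl -!scalerAl -!scalerAr !scalerA.
rewrite !exprzDr // -mulrA -mulNr -!exprz_exp -!exprnP (exprNn (U s)) !natrM exprMn.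
by rewrite -[x ^ t * _ * _]mulrA; congr (_ *: _); ring.
Qed.

End QuadraticConjugate.

(** * The companion matrix and the passage to [W] *)

Definition companion_mx (F : fieldType) (p q : F) : 'M[F]_2 :=
  \matrix_(i, j) if i == 0 then (if j == 0 then p else - q) else (j == 0)%:R.

(** Cayley-Hamilton for trace [p] and determinant [q]. *)
Lemma companion_mx_sq (F : fieldType) (p q : F) :
  companion_mx p q * companion_mx p q = p *: companion_mx p q - q%:A.
Proof.
apply/matrixP => i j; rewrite !mxE !big_ord_recl big_ord0 !mxE.
by case: i => [[|[]]] //= ?; case: j => [[|[]]] //= ?; rewrite ?mulr1n ?mulr0n; ring.
Qed.

(* On the [j]th power of the companion matrix this takes the value [W_j]. *)
Definition horadam_form (F : fieldType) (a b : F) (M : 'M[F]_2) : F :=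
  b * M 1 0 + a * M 1 1.

Lemma horadam_form_scalar (F : fieldType) (a b : F) : scalar (horadam_form a b).
Proof. by move=> c M N; rewrite /horadam_form !mxE; ring. Qed.

HB.instance Definition _ (F : fieldType) (a b : F) :=
  GRing.isLinear.Build F 'M[F]_2 F *%R (horadam_form a b) (horadam_form_scalar a b).

Theorem theorem61 (R : realType) (a b p q : complex R)
    (p_neq0 : p != 0) (q_neq0 : q != 0) (n : nat) (r s t : int) :
  let W := horadam a b p q in
  let U := lucasU p q in
  \sum_(0 <= k < n.+1)
     (-1) ^+ k * 'C(n, k)%:R ^+ 3 * U (r + s) ^+ (n - k) * U s ^+ k
     * W (t + r * k%:Z)
  = \sum_(0 <= k < n.+1)
     (-1) ^+ k * 'C(n + k, 2 * k)%:R * 'C(2 * k, k)%:R * 'C(n - k, k)%:R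
     * q ^ (s * (n%:Z - 2 * k%:Z))
     * U (r + s) ^+ k * U s ^+ k * U r ^ (n%:Z - 2 * k%:Z)
     * W (t + r * k%:Z - s * (n%:Z - 2 * k%:Z)).
Proof.
move=> W U.
have f1 : horadam_form a b 1 = a.
  by rewrite /horadam_form !mxE mulr0 add0r mulr1.
have fx : horadam_form a b (companion_mx p q) = b.
  by rewrite /horadam_form !mxE mulr1 mulr0 addr0.
have fW := scalar_quadratic_expz q_neq0 (companion_mx_sq p q) f1 fx.
have := quadratic_cube_sum q_neq0 (companion_mx_sq p q) n r s t.
move=> /(congr1 (horadam_form a b)); rewrite !linear_sum !big_mkord /= => e.
transitivity (\sum_(k < n.+1) horadam_form a b
  (((-1) ^+ k * 'C(n, k)%:R ^+ 3 * U (r + s) ^+ (n - k) * U s ^+ k)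
      *: companion_mx p q ^ (t + r * k%:Z))).
  by apply: eq_bigr => k _; rewrite linearZ /= fW.
by rewrite e; apply: eq_bigr => k _; rewrite linearZ /= fW.
Qed.
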